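(* Let $t\in(\frac12,1)$, let $\nu_t$ be the Bernoulli convolution with parameter $t$, and let $F_t(x)=\nu_t[0,x]$, $0\le x\le 1$, be its cumulative distribution function. Let $D=[1-t,t]$. Then $F_t$ defines a conjugacy between the action of $G$ on $[0,1]\setminus D$ (where $G$ is single-valued) and the doubling map $g$ on a corresponding subset of $[0,1]$. That is, $$F_t(G(x))=g(F_t(x))\qquad\text{for all } x\in[0,1]\setminus D.$$
   Context: Let $\beta=1/t$, $g_0:[0,t]\to[0,1]$, $g_0(x)=\beta x$, and $g_1:[1-t,1]\to[0,1]$, $g_1(x)=\beta x+1-\beta$. The multivalued map is $G(x)=\{g_0(x),g_1(x)\}$ (only those values that are defined); for $x\in[0,1-t)$ one has $G(x)=g_0(x)$ and for $x\in(t,1]$ one has $G(x)=g_1(x)$. The Bernoulli convolution $\nu_t$ is the unique Borel probability measure on $[0,1]$ with $\nu_t(A)=\frac12\nu_t(g_0(A))+\frac12\nu_t(g_1(A))$ for all Borel sets $A\subset[0,1]$, where $g_i(A)$ means the image of the intersection of $A$ with the domain of $g_i$. The doubling map is $g(x)=2x$ for $0\le x<\frac12$ and $g(x)=2x-1$ for $\frac12\le x\le1$ (so $g(1)=1$). *)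

(* Defs.v *)
From HB Require Import structures.
From mathcomp Require Import all_boot all_order all_algebra.
From mathcomp Require Import all_classical all_reals all_analysis.
Set Implicit Arguments.
Unset Strict Implicit.
Unset Printing Implicit Defensive.
Import Order.TTheory GRing.Theory Num.Theory.
Import numFieldNormedType.Exports.
Local Open Scope classical_set_scope.
Local Open Scope ring_scope.

(* The branches g_0 and g_1 are total functions here; their domains are [dom0]
   and [dom1], and are imposed explicitly wherever the branches are used. *)
Definition g0 (R : realType) (t x : R) : R := t^-1 * x.
Definition g1 (R : realType) (t x : R) : R := t^-1 * x + 1 - t^-1.
Definition dom0 (R : realType) (t : R) : set R := `[0, t]%classic.
Definition dom1 (R : realType) (t : R) : set R := `[1 - t, 1]%classic.

Definition G (R : realType) (t x : R) : set R :=
  [set y | (dom0 t x /\ y = g0 t x) \/ (dom1 t x /\ y = g1 t x)].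

(* Only used on [0, 1]. *)
Definition doubling (R : realType) (x : R) : R :=
  if x < 2^-1 then 2 * x else 2 * x - 1.

(* A Borel probability measure on [0, 1] is represented by a Borel probability
   measure on R giving mass 1 to [0, 1]. *)
Definition bernoulli_convolution (R : realType) (t : R)
    (nu : probability (measurableTypeR R) R) : Prop :=
  nu `[0, 1]%classic = 1%E /\
  forall A : set (measurableTypeR R), measurable A -> A `<=` `[0, 1]%classic ->
    nu A = ((2^-1)%:E * nu (g0 t @` (A `&` dom0 t)) +
            (2^-1)%:E * nu (g1 t @` (A `&` dom1 t)))%E.

Definition cdf01 (R : realType) (nu : probability (measurableTypeR R) R)
    (x : R) : R := fine (nu `[0, x]%classic).

Definition homeomorphism (T U : topologicalType) (X : set T) (Y : set U)
    (h : T -> U) : Prop :=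
  set_bij X Y h /\ {within X, continuous h} /\
  exists k : U -> T,
    (forall x, X x -> k (h x) = x) /\ {within Y, continuous k}.

(* X need not be invariant under Phi. The second clause says that Phi is
   single-valued on X and that its value y satisfies h y = psi (h x). *)
Definition conjugacy (T U : topologicalType) (X : set T) (Y : set U)
    (Phi : T -> set T) (psi : U -> U) (h : T -> U) : Prop :=
  homeomorphism X Y h /\
  forall x, X x -> exists2 y, Phi x = [set y] & h y = psi (h x).

(* Main.v *)
(** Since nu lives on [0, 1], self-similarity reads
    nu[a, b] = (nu[g_0 a, g_0 b] + nu[g_1 a, g_1 b]) / 2 for all real a, b.
    Taking a = 0 with b < 1 - t, resp. b > t, one of the two terms is 0, resp. 1,
    which is the conjugacy equation.  Both branches expand lengths by 1/t:
    pulling a nondegenerate interval forward inside [0, 1] until it has length 1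
    shows that its mass is positive, so F_t is strictly increasing.  Moreover a
    uniform bound c on the mass of short intervals improves to q c, q < 1, on
    shorter ones: near 0 only g_0 contributes, and away from 0 iterating g_0
    leaves [0, 1] after boundedly many steps.  Hence F_t is uniformly
    continuous, and its inverse is continuous by compactness. *)

Require Import Defs.
From mathcomp Require Import all_boot all_order all_algebra.
From mathcomp Require Import all_classical all_reals all_analysis.
From mathcomp Require Import ring lra.
Import Order.TTheory GRing.Theory Num.Theory.
Import numFieldNormedType.Exports.
Local Open Scope classical_set_scope.
Local Open Scope ring_scope.

(** * Masses of closed intervals *)

Definition mass (R : realType) (nu : probability (measurableTypeR R) R)
    (a b : R) : R := fine (nu `[a, b]%classic).
Arguments mass {R}.

Section Mass.
Context (R : realType) (nu : probability (measurableTypeR R) R).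
Implicit Types a b c x y : R.

Lemma mass_EFin a b : nu `[a, b]%classic = (mass nu a b)%:E.
Proof. by rewrite /mass fineK// fin_num_measure. Qed.

Lemma mass_ge0 a b : 0 <= mass nu a b.
Proof. by rewrite -lee_fin -mass_EFin. Qed.

Lemma mass_le1 a b : mass nu a b <= 1.
Proof. by rewrite -lee_fin -mass_EFin probability_le1. Qed.

Lemma le_mass a b a' b' : a' <= a -> b <= b' -> mass nu a b <= mass nu a' b'.
Proof.
move=> aa bb; rewrite -lee_fin -!mass_EFin le_measure ?inE//.
by move=> x /=; rewrite !in_itv/= => /andP[ax xb]; apply/andP; split; lra.
Qed.

(** Only an inequality, since [x] lies in both intervals and could still be an atom at this
    stage. *)
Lemma mass_split a x b : mass nu a b <= mass nu a x + mass nu x b.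
Proof.
rewrite -lee_fin EFinD -!mass_EFin.
have mA : measurable (`[a, x]%classic : set (measurableTypeR R)) by [].
have mB : measurable (`[x, b]%classic : set (measurableTypeR R)) by [].
apply: (le_trans _ (measureU2 nu mA mB)); rewrite le_measure ?inE//.
  exact: measurableU.
move=> y /=; rewrite !in_itv/= => /andP[ay yb].
by case: (leP y x) => yx; [left|right]; apply/andP; split=> //; exact: ltW.
Qed.

Lemma massD_le a x y b : a <= y -> x < y -> x <= b ->
  mass nu a x + mass nu y b <= mass nu a b.
Proof.
move=> ay xy xb; rewrite -lee_fin EFinD -!mass_EFin -measureU//.
- rewrite le_measure ?inE//; first exact: measurableU.
  by move=> z /=; rewrite !in_itv/= => -[|] /andP[h1 h2]; apply/andP; split; lra.
- by rewrite -subset0 => z /=; rewrite !in_itv/= => -[/andP[h1 h2] /andP[h3 h4]]; lra.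
Qed.

Lemma mass_full a b : nu `[0, 1]%classic = 1%E -> a <= 0 -> 1 <= b ->
  mass nu a b = 1.
Proof.
move=> nu01 a0 b1; apply/eqP; rewrite eq_le mass_le1/=.
by apply: le_trans (le_mass 0 1 _ _ a0 b1); rewrite /mass nu01.
Qed.

(** The complement of [[0, 1]] is null. This lets intervals overshoot [[0, 1]] and frees later
    formulas from the branch domains. *)
Lemma measure_restrict01 (A : set (measurableTypeR R)) :
  nu `[0, 1]%classic = 1%E -> measurable A ->
  nu A = nu (A `&` `[0, 1]%classic).
Proof.
move=> nu01 mA.
have m01 : measurable (`[0, 1]%classic : set (measurableTypeR R)) by [].
have nu0 : nu (~` `[0, 1]%classic) = 0%E.
  by rewrite probability_setC// nu01 subee.
rewrite [LHS](measureDI nu mA m01) [X in (X + _)%E](_ : _ = 0%E) ?add0e//.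
apply/eqP; rewrite -measure_le0 -nu0 le_measure ?inE//.
- exact: measurableD.
- exact: measurableC.
Qed.

Lemma mass_lt0 a b : nu `[0, 1]%classic = 1%E -> b < 0 -> mass nu a b = 0.
Proof.
move=> nu01 b0; rewrite /mass measure_restrict01//.
rewrite [X in nu X](_ : _ = set0) ?measure0// -subset0 => z /=.
rewrite !in_itv/= => -[/andP[_ zb] /andP[z0 _]].
by move: (le_lt_trans (le_trans z0 zb) b0); rewrite ltxx.
Qed.

Lemma mass_gt1 a b : nu `[0, 1]%classic = 1%E -> 1 < a -> mass nu a b = 0.
Proof.
move=> nu01 a1; rewrite /mass measure_restrict01//.
rewrite [X in nu X](_ : _ = set0) ?measure0// -subset0 => z /=.
rewrite !in_itv/= => -[/andP[az _] /andP[_ z1]].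
by move: (lt_le_trans a1 (le_trans az z1)); rewrite ltxx.
Qed.

Lemma mass_clip a b : nu `[0, 1]%classic = 1%E -> a <= 0 ->
  mass nu a b = mass nu 0 b.
Proof.
move=> nu01 a0; rewrite /mass measure_restrict01// [in RHS]measure_restrict01//.
congr (fine (nu _)); apply/seteqP.
by split=> z /=; rewrite !in_itv/= => -[/andP[za zb] /andP[z0 z1]];
  rewrite z0 z1 zb ?(le_trans a0).
Qed.

End Mass.

(** * The two branches and self-similarity of interval masses *)

Section Bernoulli.
Context (R : realType) (t : R) (nu : probability (measurableTypeR R) R).
Context (t_gt : 2^-1 < t) (t_lt1 : t < 1) (nuP : bernoulli_convolution t nu).
Implicit Types a b c d x y : R.

Let t_gt0 : 0 < t. Proof. by apply: lt_trans t_gt; rewrite invr_gt0. Qed.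
Let nu01 : nu `[0, 1]%classic = 1%E. Proof. by case: nuP. Qed.

(** Multiplying by [t] makes comparisons with the branches division-free. *)
Lemma g0E x : t * g0 t x = x.
Proof. by rewrite /g0 mulrA mulfV ?mul1r// gt_eqF. Qed.

Lemma g1E x : t * g1 t x = x + t - 1.
Proof. by rewrite /g1 mulrBr mulrDr mulrA mulfV ?gt_eqF// mul1r mulr1. Qed.

Lemma le_g0 x y : (g0 t x <= y) = (x <= t * y).
Proof. by rewrite -(ler_pM2l t_gt0) g0E. Qed.
Lemma ge_g0 x y : (y <= g0 t x) = (t * y <= x).
Proof. by rewrite -(ler_pM2l t_gt0) g0E. Qed.
Lemma lt_g0 x y : (g0 t x < y) = (x < t * y).
Proof. by rewrite -(ltr_pM2l t_gt0) g0E. Qed.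
Lemma gt_g0 x y : (y < g0 t x) = (t * y < x).
Proof. by rewrite -(ltr_pM2l t_gt0) g0E. Qed.
Lemma le_g1 x y : (g1 t x <= y) = (x + t - 1 <= t * y).
Proof. by rewrite -(ler_pM2l t_gt0) g1E. Qed.
Lemma ge_g1 x y : (y <= g1 t x) = (t * y <= x + t - 1).
Proof. by rewrite -(ler_pM2l t_gt0) g1E. Qed.
Lemma lt_g1 x y : (g1 t x < y) = (x + t - 1 < t * y).
Proof. by rewrite -(ltr_pM2l t_gt0) g1E. Qed.

Lemma g0B x y : t * (g0 t y - g0 t x) = y - x.
Proof. by rewrite mulrBr !g0E. Qed.

Lemma g1B x y : t * (g1 t y - g1 t x) = y - x.
Proof. by rewrite mulrBr !g1E; ring. Qed.

Let mulr_bound y : 0 <= y -> y <= 1 -> 0 <= t * y /\ t * y <= t.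
Proof. by move=> y0 y1; split; [exact: mulr_ge0 (ltW _) y0|rewrite ger_pMr]. Qed.

(** [g0 t] is an increasing bijection from [dom0 t] onto [[0, 1]], so the domain turns into the
    factor [[0, 1]] of the image. *)
Lemma g0_image_itv a b :
  g0 t @` (`[a, b]%classic `&` `[0, 1]%classic `&` dom0 t) =
  `[g0 t a, g0 t b]%classic `&` `[0, 1]%classic.
Proof.
apply/seteqP; split=> y /=.
- move=> [x [[]]]; rewrite /dom0/= !in_itv/= => abx x01 x0t <-.
  by rewrite !le_g0 !ge_g0 !g0E mulr0 mulr1.
- rewrite !in_itv/= !le_g0 !ge_g0 => -[aby /andP[y0 y1]]; exists (t * y).
    have [ty0 tyt] := mulr_bound _ y0 y1.
    by rewrite /dom0/= !in_itv/= aby ty0 tyt (le_trans tyt (ltW t_lt1)).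
  by rewrite /g0 mulrA mulVf ?mul1r// gt_eqF.
Qed.

Lemma g1_image_itv a b :
  g1 t @` (`[a, b]%classic `&` `[0, 1]%classic `&` dom1 t) =
  `[g1 t a, g1 t b]%classic `&` `[0, 1]%classic.
Proof.
apply/seteqP; split=> y /=.
- move=> [x [[]]]; rewrite /dom1/= !in_itv/= => abx x01 x0t <-.
  rewrite !le_g1 !ge_g1 !g1E mulr0 mulr1.
  move: abx x0t => /andP[ax xb] /andP[x0 x1].
  by split; apply/andP; split; move: t_lt1; lra.
- rewrite !in_itv/= !le_g1 !ge_g1 => -[/andP[aby yby] /andP[y0 y1]].
  (* The inverse of [g1 t] at [y]. *)
  exists (t * y + 1 - t).
    have [ty0 tyt] := mulr_bound _ y0 y1; rewrite /dom1/= !in_itv/=.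
    by split; [split|]; apply/andP; split; move: t_lt1; lra.
  by apply: (mulfI (lt0r_neq0 t_gt0)); rewrite g1E; lra.
Qed.

(* No domain appears: outside [0, 1] both sides lose mass in the same way. *)
Lemma massE a b : mass nu a b =
  2^-1 * mass nu (g0 t a) (g0 t b) + 2^-1 * mass nu (g1 t a) (g1 t b).
Proof.
apply/EFin_inj; rewrite EFinD !EFinM -!mass_EFin.
rewrite measure_restrict01// nuP.2//; last by apply: measurableI.
rewrite [in RHS]measure_restrict01// [X in _ = (_ + _ * X)%E]measure_restrict01//.
by rewrite g0_image_itv g1_image_itv.
Qed.

(** * Uniformly small mass of short intervals *)

(* At most [n + 1] applications of [g0] move the interval beyond 1; the branch of
   weight [2^-(n+1)] that leaves [0, 1] this way carries no mass. *)
Lemma mass_contract c d : 0 <= c -> 0 < d ->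
  (forall a b, b - a <= d -> mass nu a b <= c) ->
  forall n a b, t ^+ n.+1 < a -> b - a <= t ^+ n.+1 * d ->
    mass nu a b <= (1 - 2^-1 ^+ n.+1) * c.
Proof.
move=> c0 d0 dc; elim=> [|n IHn] a b ta ab; rewrite massE.
  rewrite mass_gt1 ?gt_g0 ?mulr1 ?expr1// mulr0 add0r.
  have /dc : g1 t b - g1 t a <= d by rewrite -(ler_pM2l t_gt0) g1B.
  by lra.
have tn1 : t ^+ n.+1 <= 1 by rewrite exprn_ile1// ltW.
have /IHn : t ^+ n.+1 < g0 t a by rewrite gt_g0 -exprS.
move=> /(_ (g0 t b)).
rewrite -(ler_pM2l t_gt0) g0B mulrA -exprS => /(_ ab).
have /dc : g1 t b - g1 t a <= d.
  rewrite -(ler_pM2l t_gt0) g1B (le_trans ab)// exprS -mulrA ler_pM2l//.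
  by rewrite ger_pMl.
(* The bounds [(1 - 2^-(n+1)) c] for the [g0] branch and [c] for the [g1] branch average to
   [(1 - 2^-(n+2)) c]. *)
rewrite (exprS _ n.+1); lra.
Qed.

Let expr_small e : 0 < e -> exists n, t ^+ n < e.
Proof.
move=> e0; have /cvgrPdist_lt/(_ e e0)[n _ /(_ n (leqnn n))] : t ^+ n @[n --> \oo] --> 0.
  by apply: cvg_expr; rewrite gtr0_norm.
by rewrite /= sub0r normrN gtr0_norm ?exprn_gt0//; exists n.
Qed.

(** The factor [q] is the same at every stage and only [d] shrinks, so the bounds tend to 0; in
    particular there are no atoms. *)
Lemma mass_small :
  exists2 q, 0 <= q < 1 & forall n, exists2 d, 0 < d &
    forall a b, b - a <= d -> mass nu a b <= q ^+ n.
Proof.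
(* An interval starting at or below [t ^+ N.+1], of length at most [(1 - t) / 2], then ends before
   [1 - t], so its [g1] image lies below 0. *)
have [N tN] : exists N, t ^+ N < (1 - t) / 2.
  by apply: expr_small; rewrite divr_gt0// subr_gt0.
have tN1 : t ^+ N.+1 < (1 - t) / 2.
  by apply: le_lt_trans tN; rewrite ler_wiXn2l ?(ltW t_gt0) ?(ltW t_lt1).
(* This gives [q >= 1/2]: near 0 the single contributing branch has weight 1/2, which must not
   exceed [q]. *)
have h1 : 2^-1 ^+ N.+1 <= 2^-1 :> R.
  by rewrite exprS ger_pMr// exprn_ile1// ?invr_ge0// invf_le1 ?ler1n.
have h0 : 0 < 2^-1 ^+ N.+1 :> R by rewrite exprn_gt0// invr_gt0.
exists (1 - 2^-1 ^+ N.+1); first by apply/andP; split; lra.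
have q0 : 0 <= 1 - 2^-1 ^+ N.+1 :> R by lra.
elim=> [|n [d d0 IHd]]; first by exists 1 => // a b _; rewrite expr0 mass_le1.
exists (Num.min (t ^+ N.+1 * d) ((1 - t) / 2)).
  by rewrite lt_min mulr_gt0 ?exprn_gt0// divr_gt0// subr_gt0.
move=> a b; rewrite le_min => /andP[abd abt].
have [ta|aN] := ltP (t ^+ N.+1) a.
  by rewrite exprS; exact: (mass_contract _ _ (exprn_ge0 _ q0) d0 IHd).
rewrite massE [X in _ + _ * X]mass_lt0//; last first.
  by rewrite lt_g1 mulr0; move: t_lt1; lra.
rewrite mulr0 addr0 exprS ler_pM ?mass_ge0//; first lra.
apply: IHd; rewrite -(ler_pM2l t_gt0) g0B (le_trans abd)// exprS -mulrA.
by rewrite ler_pM2l// ger_pMl// exprn_ile1// ltW.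
Qed.

(** * Positive mass of nondegenerate intervals *)

Lemma mass_pos_r n a : 0 <= a -> t ^+ n <= 1 - a -> 0 < mass nu a 1.
Proof.
elim: n a => [|n IHn] a a0 ta.
  by rewrite mass_full//; move: ta; rewrite expr0; lra.
rewrite massE ltr_wpDl//; first by rewrite mulr_ge0// mass_ge0.
(* Since [g1] fixes 1, this branch keeps the right end while the length grows by [1/t], until the
   interval covers [[0, 1]]. *)
rewrite mulr_gt0//; have g11 : g1 t 1 = 1 by rewrite /g1; lra.
rewrite g11; have [g1a|g1a] := leP 0 (g1 t a); last first.
  by rewrite mass_full// ltW.
apply: IHn => //; rewrite -(ler_pM2l t_gt0) mulrBr g1E -exprS.
by apply: (le_trans ta); lra.
Qed.

Lemma mass_pos n a b : 0 <= a -> b <= 1 -> t ^+ n <= b - a -> 0 < mass nu a b.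
Proof.
elim: n a b => [|n IHn] a b a0 b1 tab.
  by rewrite mass_full//; move: tab; rewrite expr0; lra.
have m0 c d : 0 <= 2^-1 * mass nu c d by rewrite mulr_ge0// mass_ge0.
rewrite massE; have [bt|tb] := leP b t.
  rewrite ltr_pwDl// mulr_gt0// IHn ?ge_g0 ?mulr0 ?le_g0 ?mulr1//.
  by rewrite -(ler_pM2l t_gt0) g0B -exprS.
have [ta|aN] := leP (1 - t) a.
  rewrite ltr_wpDl// mulr_gt0// IHn ?ge_g1 ?mulr0 ?le_g1 ?mulr1//; [lra|lra|].
  by rewrite -(ler_pM2l t_gt0) g1B -exprS.
(* Now [[a, b]] contains [[1 - t, t]] and neither image stays in [[0, 1]]. The [g0] image covers the
   final segment [[g0 t a, 1]], nondegenerate because [a < 1 - t < t]. *)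
have g0a : g0 t a < 1.
  by rewrite lt_g0 mulr1 (lt_trans aN)//; move: t_gt; lra.
have [m /ltW tm] : exists m, t ^+ m < 1 - g0 t a by apply: expr_small; lra.
rewrite ltr_pwDl// mulr_gt0//; apply: (lt_le_trans (mass_pos_r m _ _ tm)).
  by rewrite ge_g0 mulr0.
by rewrite le_mass// ge_g0 mulr1 ltW.
Qed.

(** * Monotonicity, continuity and functional equations of the distribution function *)

Lemma cdf01_lt x y : 0 <= x -> x < y -> y <= 1 -> cdf01 nu x < cdf01 nu y.
Proof.
(* The midpoint leaves a gap that makes the closed intervals [[0, x]] and [[z, y]] disjoint. *)
move=> x0 xy y1; pose z := (x + y) / 2.
have [n /ltW tn] : exists n, t ^+ n < y - z by apply: expr_small; rewrite /z; lra.
have zy : 0 < mass nu z y by apply: mass_pos tn => //; rewrite /z; lra.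
have : mass nu 0 x + mass nu z y <= mass nu 0 y by apply: massD_le; rewrite /z; lra.
by rewrite /cdf01 -!/(mass _ _ _); lra.
Qed.

Lemma cdf01_inj : {in `[0, 1]%classic &, injective (cdf01 nu)}.
Proof.
move=> x y; rewrite !inE/= !in_itv/= => /andP[x0 x1] /andP[y0 y1] Fxy.
by have [/cdf01_lt|/cdf01_lt|//] := ltgtP x y => /(_ ltac:(done) ltac:(done));
  rewrite Fxy ltxx.
Qed.

(** The bounds of [mass_small] hold for intervals anywhere in [R], so the end points 0 and 1 need no
    separate treatment. *)
Lemma cdf01_continuous : continuous (cdf01 nu).
Proof.
have [q /andP[q0 q1] small] := mass_small.
have le_cdf x y : x <= y ->
    cdf01 nu x <= cdf01 nu y <= cdf01 nu x + mass nu x y.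
  by move=> xy; rewrite /cdf01 -!/(mass _ _ _) le_mass// mass_split.
move=> x; apply/cvgrPdist_lt => e e0.
have /cvgrPdist_lt/(_ e e0)[n _ /(_ n (leqnn n))] : q ^+ n @[n --> \oo] --> 0.
  by apply: cvg_expr; rewrite ger0_norm.
rewrite /= sub0r normrN ger0_norm ?exprn_ge0// => qn.
have [d d0 dq] := small n.
near=> y; have : `|x - y| < d by near: y; apply: cvgr_dist_lt.
rewrite !ltr_norml => /andP[xyd yxd].
have [xy|/ltW yx] := leP x y.
  by have := dq x y; have := le_cdf x y xy; lra.
by have := dq y x; have := le_cdf y x yx; lra.
Unshelve. all: by end_near. Qed.

Lemma cdf01_g0 x : x < 1 - t -> cdf01 nu (g0 t x) = 2 * cdf01 nu x.
Proof.
move=> xt; rewrite /cdf01 -!/(mass _ _ _) [in RHS]massE.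
rewrite [X in _ + _ * X]mass_lt0//; last by rewrite lt_g1 mulr0; lra.
by rewrite [g0 t 0]mulr0; lra.
Qed.

Lemma cdf01_g1 x : t < x -> cdf01 nu (g1 t x) = 2 * cdf01 nu x - 1.
Proof.
move=> xt; rewrite /cdf01 -!/(mass _ _ _) [in RHS]massE.
rewrite [mass nu (g0 t 0) _]mass_full ?[g0 t 0]mulr0 ?ge_g0 ?mulr1 ?(ltW xt)//.
rewrite [X in _ + _ * X]mass_clip//; first lra.
by rewrite le_g1 mulr0; move: t_lt1; lra.
Qed.

End Bernoulli.

(** * Conjugacy with the doubling map *)

Theorem proposition8 (R : realType) (t : R)
    (nu : probability (measurableTypeR R) R) :
  2^-1 < t -> t < 1 -> bernoulli_convolution t nu ->
  exists2 Y : set R, Y `<=` `[0, 1]%classic &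
    conjugacy (`[0, 1]%classic `\` `[1 - t, t]%classic) Y (G t) (@doubling R) (cdf01 nu).
Proof.
move=> t2 t1 nuP.
set X := `[0, 1]%classic `\` `[1 - t, t]%classic.
have X01 : X `<=` `[0, 1]%classic by exact: subDsetl.
have Finj := cdf01_inj _ _ _ t2 t1 nuP.
have Fcont := cdf01_continuous _ _ _ t2 t1 nuP.
exists (cdf01 nu @` X).
  by move=> _ [x _ <-]; rewrite /= in_itv/=; apply/andP; split;
    [exact: mass_ge0|exact: mass_le1].
split.
  split; [|split].
  - split=> // x y /set_mem/X01 x01 /set_mem/X01 y01; exact: Finj (mem_set _) (mem_set _).
  - exact: continuous_subspaceT.
  (* The inverse is built over the compact [[0, 1]], where its continuity is automatic, and then
     restricted to the image of [X], which is not compact. *)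
  - pose k := 'pinv_(fun=> 0) `[0, 1]%classic (cdf01 nu).
    have Fk : {in `[0, 1], cancel (cdf01 nu) k}.
      by move=> x x01; apply: pinvKV => //; exact: mem_set.
    exists k; split; first by move=> x /X01; exact: Fk.
    have := segment_can_le_continuous ler01 (continuous_subspaceT Fcont) Fk.
    apply: continuous_subspaceW => _ [x /X01 + <-].
    rewrite /= !in_itv/= => /andP[x0 x1].
    by rewrite /cdf01 -!/(mass _ _ _) !le_mass.
move=> x []; rewrite /= in_itv/= => /andP[x0 x1]; rewrite in_itv/= => /negP.
rewrite negb_and -!ltNge => /orP[xt|tx].
- exists (g0 t x).
    apply/seteqP; split=> y /=; rewrite /G/= /dom0 /dom1/= !in_itv/=.
      by case=> -[/andP[h1 h2] ->//]; lra.
    by move=> ->; left; split=> //; apply/andP; split; lra.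
  rewrite (cdf01_g0 _ _ _ t2 t1 nuP)// /doubling ifT//.
  (* Strict monotonicity is essential: [2 F(x) = F(g0 x) < F(1) <= 1] puts [F(x)] strictly below
     1/2, in the first case of [doubling]. *)
  have gx1 : g0 t x < 1 by rewrite lt_g0 ?mulr1; lra.
  have : cdf01 nu (g0 t x) < cdf01 nu 1.
    by apply: (cdf01_lt _ _ _ t2 t1 nuP) => //; rewrite ge_g0 ?mulr0; lra.
  rewrite (cdf01_g0 _ _ _ t2 t1 nuP)//.
  by have := mass_le1 R nu 0 1; rewrite /cdf01 -!/(mass _ _ _); lra.
- exists (g1 t x).
    apply/seteqP; split=> y /=; rewrite /G/= /dom0 /dom1/= !in_itv/=.
      by case=> -[/andP[h1 h2] ->//]; lra.
    by move=> ->; right; split=> //; apply/andP; split; lra.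
  have E := cdf01_g1 _ _ _ t2 t1 nuP x tx.
  (* As this value is [2 F(x) - 1], it follows that [F(x) >= 1/2], the second case of [doubling]. *)
  have : 0 <= cdf01 nu (g1 t x) by exact: mass_ge0.
  by rewrite /doubling E; case: ifP => // ? ?; lra.
Qed.
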